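(* Let $G$ be a (countable) residually finite group and let $(H_n)_n$ be a descending chain of finite index subgroups of $G$ such that the associated profinite action $a^{(H_n)}$ is free. Then for every measure preserving action $b$ of $G$ on a standard probability space $(\mathfrak{X},\mu)$, we have $\mathrm{h}_{\Sigma_{(H_n)}}(b)>-\infty$ if and only if $b$ is weakly contained in the profinite action $a^{(H_n)}$.
   Context: Fix a non-principal ultrafilter $\mathfrak{u}$ on $\mathbf{N}$. All actions are probability measure preserving (pmp); $(\mathfrak{X}_a,\mu_a)$ is the space of the action $a$. Weak containment: $a\prec b$ if for every $\varepsilon>0$, every finite measurable partition $\{A_1,\ldots,A_n\}$ of $\mathfrak{X}_a$ and every finite $F\subset G$ there is a measurable partition $\{B_1,\ldots,B_n\}$ of $\mathfrak{X}_b$ such that $\sum_{i,j\leq n}\sum_{f\in F}|\mu_a(A_i\cap fA_j)-\mu_b(B_i\cap fB_j)|<\varepsilon$. Profinite actions: each $G/H_n$ carries the normalized counting measure and the left translation action; $a^{(H_n)}$ is the action of $G$ on $\varprojlim G/H_n$ with the inverse limit measure. Free means that for every $g\neq 1_G$ the set of points fixed by $g$ has measure $0$. Sofic approximations: let $\mathbf{F}$ be a countable free group, $\pi:\mathbf{F}\to G$ a surjective homomorphism and $\rho:G\to\mathbf{F}$ a section of $\pi$ with $\rho(1)=1$. A sofic approximation $\Sigma=(a_n)_n$ of $G$ is a sequence of actions of $\mathbf{F}$ on finite sets $\mathfrak{X}_{a_n}$ (with normalized counting measure $\mu_{a_n}$) such that $\lim_n\mu_{a_n}(\{x:gx=x\})=1$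 for $g\in\ker\pi$ and $=0$ for $g\notin\ker\pi$. If $a^{(H_n)}$ is free, the sequence of actions of $G$ on $G/H_n$ (viewed as actions of $\mathbf{F}$ via $\pi$) is a sofic approximation, denoted $\Sigma_{(H_n)}$. Sofic entropy: let $a$ be an action of $G$ on a standard probability space, $\alpha$ a finite partition of $\mathfrak{X}_a$, $F\subset G$ a finite subset containing $1_G$, $\delta>0$. Let $\alpha_F$ be the partition generated by the translates $f\alpha$, $f\in F$. Let $\mathrm{Hom}(a,\alpha,F,\delta,a_n)$ be the set of homomorphisms $\varphi$ from the finite measure algebra generated by $\alpha_F$ to the algebra of subsets of $\mathfrak{X}_{a_n}$ such that $\mu_{a_n}(\rho(f)\varphi(A)\,\Delta\,\varphi(fA))<\delta$ for all $A\in\alpha$, $f\in F$, and $\sum_{A\in\alpha_F}|\mu_{a_n}(\varphi(A))-\mu_a(A)|<\delta$. For a partition $\xi$ refined by $\alpha$, $|\mathrm{Hom}(a,\alpha,F,\delta,a_n)|_\xi$ is the number of distinct restrictions to $\xi$ of elements of this set. Define (with $\log 0=-\infty$) $$\mathrm{h}^\xi_\Sigma(\alpha,F,\delta,a)=\lim_{n\in\mathfrak{u}}\frac{1}{|\mathfrak{X}_{a_n}|}\log|\mathrm{Hom}(a,\alpha,F,\delta,a_n)|_\xi,\qquad \mathrm{h}_\Sigma(a)=\sup_\xi\ \inf_{\alpha}\ \inf_{F}\ \inf_{\delta>0}\ \mathrm{h}^\xi_\Sigma(\alpha,F,\delta,a),$$ where $\xi$ ranges over finite partitions of $\mathfrak{X}_a$,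 $\alpha$ over finite partitions refining $\xi$, and $F$ over finite subsets of $G$ containing $1_G$. *)

(* Defs.v *)
From HB Require Import structures.
From mathcomp Require Import all_boot all_order all_algebra finmap.
From mathcomp Require Import all_classical all_reals all_analysis.

Set Implicit Arguments.
Unset Strict Implicit.
Unset Printing Implicit Defensive.

Import Order.TTheory GRing.Theory Num.Theory.

Local Open Scope classical_set_scope.
Local Open Scope ring_scope.

(* The universal property of a basis [e]. *)
Definition free_group (FF : groupType) : Prop :=
  exists (I : Type) (e : I -> FF), forall (K : groupType) (t : I -> K),
    exists h : {multiplicative FF -> K}, (forall i, h (e i) = t i) /\
      forall h' : {multiplicative FF -> K}, (forall i, h' (e i) = t i) -> h' =1 h.

Definition lcoset_of (G : groupType) (H : {pred G}) (g : G) : set G :=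
  [set x | (g^-1 * x)%g \in H].

Record fin_index_subgroup (G : groupType) := FinIndexSubgroup {
  fis_group :> groupClosed G ;
  fis_finite : finite_set (range (lcoset_of fis_group)) }.

Definition residually_finite (G : groupType) : Prop :=
  forall g : G, g <> 1%g -> exists N : fin_index_subgroup G,
    (forall x y : G, x \in N -> (y^-1 * x * y)%g \in N) /\ g \notin N.

Definition coset_space (G : groupType) (H : fin_index_subgroup G)
    : {fset (set G)} := fset_set (range (lcoset_of H)).

Section CosetSpace.
Variables (G : groupType) (H : fin_index_subgroup G).

Lemma in_coset_space (C : set G) :
  C \in coset_space H <-> exists g, C = lcoset_of H g.
Proof.
rewrite in_fset_set; last exact: fis_finite.
by rewrite inE; split=> [[g _ <-]|[g ->]]; exists g.
Qed.

Lemma lcoset_of_in (g : G) : lcoset_of H g \in coset_space H.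
Proof. by apply/in_coset_space; exists g. Qed.

Definition base_coset : coset_space H := [` lcoset_of_in 1%g]%fset.

Definition translate (g : G) (C : set G) : set G := [set (g * x)%g | x in C].

Lemma translate_lcoset (g k : G) :
  translate g (lcoset_of H k) = lcoset_of H (g * k)%g.
Proof.
apply/seteqP; split=> [_ [x kx <-]|x gkx] /=.
  by rewrite /lcoset_of /= invgM -mulgA (mulgA g^-1)%g mulVg mul1g.
exists (g^-1 * x)%g; first by rewrite /lcoset_of /= mulgA -invgM.
by rewrite mulgA mulgV mul1g.
Qed.

Lemma translate_in (g : G) (C : coset_space H) :
  translate g (val C) \in coset_space H.
Proof.
have /in_coset_space[k ->] := valP C.
by rewrite translate_lcoset; exact: lcoset_of_in.
Qed.

Definition coset_act (g : G) (C : coset_space H) : coset_space H :=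
  [` translate_in g C]%fset.

Lemma coset_act1 (C : coset_space H) : coset_act 1%g C = C.
Proof.
apply: val_inj; apply/seteqP; split=> [_ [x Cx <-]|x Cx] /=.
  by rewrite mul1g.
by exists x => //; rewrite mul1g.
Qed.

Lemma coset_actM (g k : G) (C : coset_space H) :
  coset_act (g * k)%g C = coset_act g (coset_act k C).
Proof.
apply: val_inj; apply/seteqP; split=> [_ [x Cx <-]|_ [_ [x Cx <-] <-]] /=.
  by exists (k * x)%g; [exists x | rewrite mulgA].
by exists x => //; rewrite mulgA.
Qed.

Lemma coset_space_gt0 : (0 < #|{: coset_space H}|)%N.
Proof. by apply/card_gt0P; exists base_coset. Qed.

End CosetSpace.

Record fin_index_chain (G : groupType) := FinIndexChain {
  chain_group :> nat -> fin_index_subgroup G ;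
  chain_desc : forall n, {subset chain_group n.+1 <= chain_group n} }.

(* The bonding map [G / H_{n+1} -> G / H_n] sends a coset to the unique coset
   containing it. *)
Record profinite (G : groupType) (H : fin_index_chain G) := Profinite {
  pcoord :> forall n, coset_space (H n) ;
  pcoord_compat : forall n, val (pcoord n.+1) `<=` val (pcoord n) }.

Section ProfiniteSpace.
Variables (G : groupType) (H : fin_index_chain G).

HB.instance Definition _ := gen_eqMixin (profinite H).
HB.instance Definition _ := gen_choiceMixin (profinite H).

Lemma base_compat n :
  val (base_coset (H n.+1)) `<=` val (base_coset (H n)).
Proof. by move=> x; exact: chain_desc. Qed.

HB.instance Definition _ :=
  isPointed.Build (profinite H) (Profinite base_compat).

Definition cylinders : set (set (profinite H)) :=
  [set A | exists n (c : coset_space (H n)), A = [set x | pcoord x n = c]].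

Definition profinite_space := g_sigma_algebraType cylinders.

Lemma profinite_act_compat (g : G) (x : profinite H) n :
  val (coset_act g (x n.+1)) `<=` val (coset_act g (x n)).
Proof. by move=> _ [y xy <-]; exists y => //; exact: pcoord_compat xy. Qed.

Definition profinite_act (g : G) (x : profinite_space) : profinite_space :=
  Profinite (@profinite_act_compat g x).

End ProfiniteSpace.

(* The inverse limit of the normalized counting measures on the [G / H_n]: the
   probability measure whose projections are these measures. *)
Definition inverse_limit_measure (R : realType) (G : groupType)
    (H : fin_index_chain G) (mu : probability (profinite_space H) R) : Prop :=
  forall n (c : coset_space (H n)),
    mu [set x | pcoord x n = c] = (#|{: coset_space (H n)}|%:R^-1)%:E.

Definition standard_borel (R : realType) d (X : measurableType d) : Prop :=
  exists (P : completePseudoMetricType R) (h : X -> P),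
    [/\ hausdorff_space P, @second_countable P, bijective h &
        forall A : set X, measurable A <-> <<s @open P >> (h @` A)].

Definition pmp_action (R : realType) (G : groupType) d (X : measurableType d)
    (mu : probability X R) (a : G -> X -> X) : Prop :=
  [/\ forall x, a 1%g x = x,
      forall g k x, a (g * k)%g x = a g (a k x),
      forall g, measurable_fun setT (a g) &
      forall g (A : set X), measurable A -> mu (a g @^-1` A) = mu A].

Definition free_action (R : realType) (G : groupType) d (X : measurableType d)
    (mu : probability X R) (a : G -> X -> X) : Prop :=
  forall g, g <> 1%g -> mu [set x | a g x = x] = 0%E.

(* Some of the pieces may be empty. *)
Definition mpartition d (X : measurableType d) n (A : 'I_n -> set X) : Prop :=
  [/\ forall i, measurable (A i), trivIset setT A & \bigcup_i A i = setT].

Definition weakly_contained (R : realType) (G : groupType)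
    d (X : measurableType d) (mu : probability X R) (a : G -> X -> X)
    d' (Y : measurableType d') (nu : probability Y R) (b : G -> Y -> Y) : Prop :=
  forall (e : R), 0 < e ->
  forall n (A : 'I_n -> set X), mpartition A ->
  forall F : {fset G},
  exists2 B : 'I_n -> set Y, mpartition B &
    (\sum_(i < n) \sum_(j < n) \sum_(f <- F)
       `| mu (A i `&` (a f @` A j)) - nu (B i `&` (b f @` B j)) | < e%:E)%E.

Definition nonprincipal (u : set_system nat) : Prop := forall n, ~ u [set n].

Record fin_action (FF : groupType) := FinAction {
  fcarrier : finType ;
  fcarrier_gt0 : (0 < #|fcarrier|)%N ;
  fin_act : FF -> fcarrier -> fcarrier ;
  fin_act1 : forall y, fin_act 1%g y = y ;
  fin_actM : forall g k y, fin_act (g * k)%g y = fin_act g (fin_act k y) }.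

Section CosetFinAction.
Variables (FF G : groupType) (pi : {multiplicative FF -> G}).
Variable H : fin_index_subgroup G.

Let act (g : FF) := @coset_act G H (pi g).

Let act1 y : act 1%g y = y.
Proof.
rewrite /act (_ : pi 1%g = 1%g) ?coset_act1//.
by apply: (@mulgI _ (pi 1%g)); rewrite -gmulfM !mulg1.
Qed.

Let actM g k y : act (g * k)%g y = act g (act k y).
Proof. by rewrite /act gmulfM coset_actM. Qed.

Definition coset_fin_action : fin_action FF :=
  FinAction (coset_space_gt0 H) act1 actM.

End CosetFinAction.

Definition coset_sofic_approx (FF G : groupType) (pi : {multiplicative FF -> G})
    (H : fin_index_chain G) : nat -> fin_action FF :=
  fun n => coset_fin_action pi (H n).

Definition ncount (R : realType) (Y : finType) (A : {set Y}) : R :=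
  #|A|%:R / #|Y|%:R.

Section SoficEntropy.
Variables (R : realType) (FF G : groupType) (rho : G -> FF).
Variables (d : measure_display) (X : measurableType d) (mu : probability X R).
Variable a : G -> X -> X.

(* The pieces of the join of the [f alpha], [f \in F], indexed by the choice of
   one piece of [alpha] for each [f]. *)
Definition join_atom k (alpha : 'I_k -> set X) (F : {fset G})
    (s : {ffun F -> 'I_k}) : set X :=
  \bigcap_(f in [set: F]) (a (val f) @` alpha (s f)).

Definition join_algebra k (alpha : 'I_k -> set X) (F : {fset G})
    : set (set X) :=
  [set A | exists S : {set {ffun F -> 'I_k}},
             A = \bigcup_(s in [set` S]) join_atom alpha s].

(* The last clause makes [phi] a homomorphism on the measure algebra, in which
   sets that differ by a null set are identified.  Values of [phi] outside of
   [L] are irrelevant. *)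
Definition malg_hom (L : set (set X)) (Y : finType) (phi : set X -> {set Y})
    : Prop :=
  [/\ phi setT = [set: Y]%SET,
      forall A, L A -> phi (~` A) = (~: phi A)%SET,
      forall A B, L A -> L B -> phi (A `|` B) = (phi A :|: phi B)%SET &
      forall A B, L A -> L B -> mu ((A `\` B) `|` (B `\` A)) = 0%E ->
        phi A = phi B].

Definition sofic_hom k (alpha : 'I_k -> set X) (F : {fset G}) (delta : R)
    (c : fin_action FF) (phi : set X -> {set fcarrier c}) : Prop :=
  [/\ malg_hom (join_algebra alpha F) phi,
      forall (i : 'I_k) (f : G), f \in F ->
        let B := fin_act (rho f) @: phi (alpha i) in
        let C := phi (a f @` alpha i) in
        ncount R ((B :\: C) :|: (C :\: B))%SET < delta &
      \sum_(s : {ffun F -> 'I_k})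
         `| ncount R (phi (join_atom alpha s)) - fine (mu (join_atom alpha s)) |
        < delta].

Definition sofic_hom_card k (alpha : 'I_k -> set X) (F : {fset G}) (delta : R)
    (c : fin_action FF) m (xi : 'I_m -> set X) : nat :=
  #|[set t : {ffun 'I_m -> {set fcarrier c}} |
      `[< exists2 phi, sofic_hom alpha F delta phi & forall j, t j = phi (xi j) >]]%SET|.

Variables (u : set_system nat) (Sigma : nat -> fin_action FF).

(* [lne 0 = -oo]. *)
Definition entropy_at m (xi : 'I_m -> set X) k (alpha : 'I_k -> set X)
    (F : {fset G}) (delta : R) : \bar R :=
  lim ((fun n => (#|fcarrier (Sigma n)|%:R^-1)%:E *
        lne ((sofic_hom_card alpha F delta (Sigma n) xi)%:R%:E))%E @ u).

Definition finer k m (alpha : 'I_k -> set X) (xi : 'I_m -> set X) : Prop :=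
  forall i, exists j, alpha i `<=` xi j.

(* [Sigma] may be any sequence of finite actions; the notion is of interest when
   it is a sofic approximation. *)
Definition sofic_entropy : \bar R :=
  ereal_sup [set h | exists m (xi : 'I_m -> set X), mpartition xi /\
    h = ereal_inf [set h1 | exists k (alpha : 'I_k -> set X),
      [/\ mpartition alpha, finer alpha xi &
      h1 = ereal_inf [set h2 | exists F : {fset G}, 1%g \in F /\
        h2 = ereal_inf [set entropy_at xi alpha F delta
                        | delta in [set delta : R | 0 < delta]]]]]].

End SoficEntropy.

(* Main.v *)
(* The piece of [alpha_F] containing [x] is recorded by its name, the map
   sending [g] in [F] to the index of the piece of [alpha] containing [g^-1 x].
   An almost-homomorphism into the subsets of [G/H_n] amounts to a labelling of
   [G/H_n] by names of non-null pieces that has almost the right distribution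
   and is almost equivariant: for most [y], the label of [g^-1 y] at [1] is the
   label of [y] at [g].  Pulled back along the projection to [G/H_n], such a
   labelling gives a partition of the profinite space witnessing weak
   containment.  Conversely, weak containment applied to the partition
   [alpha_F] gives a measurable labelling of the profinite space; cylinders
   approximate measurable sets, so it is close to a labelling of [G/H_n] for
   every large [n].  Finally, the entropy is [-oo] unless almost-homomorphisms
   exist, and nonnegative if they exist for all large [n]. *)

Require Import Defs.
From HB Require Import structures.
From mathcomp Require Import all_boot all_order all_algebra finmap.
From mathcomp Require Import all_classical all_reals all_analysis.
From mathcomp Require Import lra.

Set Implicit Arguments.
Unset Strict Implicit.
Unset Printing Implicit Defensive.

Import Order.TTheory GRing.Theory Num.Theory.

Local Open Scope classical_set_scope.
Local Open Scope ring_scope.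

(** * Probabilities as real numbers, partitions as finite-valued maps *)

Section ProbabilityReal.
Variables (R : realType) (d : measure_display) (T : measurableType d).
Variable P : probability T R.
Implicit Types A B C E : set T.

Lemma probability_fineE A : measurable A -> P A = (fine (P A))%:E.
Proof. by move=> mA; rewrite fineK// fin_num_measure. Qed.

Lemma fine_probability_leU A B C : measurable A -> measurable B ->
  measurable C -> A `<=` B `|` C -> fine (P A) <= fine (P B) + fine (P C).
Proof.
move=> mA mB mC ABC; rewrite -fineD ?fin_num_measure// fine_le//.
- exact: fin_num_measure.
- by rewrite fin_numD !fin_num_measure.
apply: (le_trans (le_measure _ _ _ ABC)); rewrite ?inE//.
  exact: measurableU.
exact: measureU2.
Qed.

Lemma fine_probability_dist A B E : measurable A -> measurable B ->
  measurable E -> A `<=` B `|` E -> B `<=` A `|` E ->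
  `|fine (P A) - fine (P B)| <= fine (P E).
Proof.
move=> mA mB mE AB BA; rewrite ler_distl.
have := fine_probability_leU mA mB mE AB.
have := fine_probability_leU mB mA mE BA.
by lra.
Qed.

Lemma fine_probability_le_sum (I : finType) A (B : I -> set T) :
  measurable A -> (forall i, measurable (B i)) -> A `<=` \bigcup_i B i ->
  fine (P A) <= \sum_i fine (P (B i)).
Proof.
move=> mA mB AB.
suff: forall (s : seq I) A, measurable A ->
    A `<=` \big[setU/set0]_(i <- s) B i ->
    fine (P A) <= \sum_(i <- s) fine (P (B i)).
  apply => //; rewrite -bigcup_seq => x /AB[i _ Bix]; exists i => //.
  by rewrite /= mem_index_enum.
elim=> [|i s IH] {AB mA}A mA.
  by rewrite !big_nil subset0 => ->; rewrite measure0.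
rewrite !big_cons => AB; have mC : measurable (\big[setU/set0]_(i <- s) B i).
  by apply: bigsetU_measurable.
exact: le_trans (fine_probability_leU mA (mB i) mC AB)
  (lerD (lexx _) (IH _ mC (@subset_refl _ _))).
Qed.

(* A finite measurable partition of [T] is encoded by the map sending a point to
   the index of its piece. *)
Definition fin_measurable (I : finType) (f : T -> I) : Prop :=
  forall D : set I, measurable (f @^-1` D).

Lemma fin_measurable_fibers (I : finType) (f : T -> I) :
  (forall i, measurable (f @^-1` [set i])) -> fin_measurable f.
Proof.
move=> mf D.
have -> : f @^-1` D = \bigcup_(i in D) f @^-1` [set i].
  by apply/seteqP; split=> [x Dx|x [i Di] /= ->]; first exists (f x).
exact: fin_bigcup_measurable.
Qed.

Lemma fin_measurable_comp (I J : finType) (f : T -> I) (g : I -> J) :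
  fin_measurable f -> fin_measurable (g \o f).
Proof. by move=> mf D; rewrite comp_preimage; exact: mf. Qed.

Lemma fin_measurable_pair (I J : finType) (f : T -> I) (g : T -> J) :
  fin_measurable f -> fin_measurable g -> fin_measurable (fun x => (f x, g x)).
Proof.
move=> mf mg; apply: fin_measurable_fibers => -[i j].
have -> : (fun x => (f x, g x)) @^-1` [set (i, j)] =
    f @^-1` [set i] `&` g @^-1` [set j].
  by apply/seteqP; split=> x /= [-> ->].
exact: measurableI.
Qed.

Lemma fine_probability_preimage (I : finType) (f : T -> I) (D : {pred I}) :
  fin_measurable f ->
  fine (P (f @^-1` [set i | i \in D])) =
  \sum_(i in D) fine (P (f @^-1` [set i])).
Proof.
move=> mf.
have -> : f @^-1` [set i | i \in D] =
    \bigcup_(i in [set` enum D]) f @^-1` [set i].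
  apply/seteqP; split=> [x Dx|x [i /=]].
    by exists (f x); rewrite //= mem_enum.
  by rewrite mem_enum => Di ->.
rewrite measure_fin_bigcup//; last by move=> i j _ _ [x [<- <-]].
rewrite -fsbig_seq ?enum_uniq//= big_enum/= sum_fine// => i _.
exact: fin_num_measure.
Qed.

End ProbabilityReal.

(** Both probabilities are sums over [D], so the distance between the two distributions, summed over
    all of [I], controls every event at once. *)
Lemma fine_probability_preimage_dist (R : realType)
    (d : measure_display) (T : measurableType d) (P : probability T R)
    (d' : measure_display) (T' : measurableType d') (P' : probability T' R)
    (I : finType) (f : T -> I) (f' : T' -> I) (D : {pred I}) :
  fin_measurable f -> fin_measurable f' ->
  `|fine (P (f @^-1` [set i | i \in D])) -
    fine (P' (f' @^-1` [set i | i \in D]))|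
  <= \sum_i `|fine (P (f @^-1` [set i])) - fine (P' (f' @^-1` [set i]))|.
Proof.
move=> mf mf'; rewrite !fine_probability_preimage// -sumrB.
apply: le_trans (ler_norm_sum _ _ _) _.
by rewrite [leRHS](bigID (mem D))/= lerDl sumr_ge0.
Qed.

Section Partitions.
Variables (d : measure_display) (T : measurableType d).

Lemma mpartition_index n (A : 'I_n -> set T) : mpartition A ->
  exists2 f : T -> 'I_n, fin_measurable f &
    A = fun i => f @^-1` [set i].
Proof.
move=> [mA tA covA].
have /choice[f fA] : forall x, exists i, A i x.
  move=> x; have [i _ Aix] : (\bigcup_i A i) x by rewrite covA.
  by exists i.
have AE : A = fun i => f @^-1` [set i].
  apply/funext => i; apply/seteqP; split=> [x Aix|x /= <-]; last exact: fA.
  by apply: (tA _ _ I I); exists x; split; [exact: fA|].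
by exists f => //; apply: fin_measurable_fibers => i; rewrite AE in mA.
Qed.

Lemma index_mpartition n (f : T -> 'I_n) : fin_measurable f ->
  mpartition (fun i => f @^-1` [set i]).
Proof.
move=> mf; split=> [i||]; first exact: mf.
  by move=> i j _ _ [x [/= <- <-]].
by apply/seteqP; split=> // x _; exists (f x).
Qed.

End Partitions.

(* Finite Stone duality. *)
Lemma boolean_hom_dual (I Y : finType) (Phi : {set I} -> {set Y}) :
  Phi [set: I]%SET = [set: Y]%SET ->
  (forall S, Phi (~: S)%SET = (~: Phi S)%SET) ->
  (forall S S', Phi (S :|: S')%SET = (Phi S :|: Phi S')%SET) ->
  exists kap : Y -> I, forall S, Phi S = (kap @^-1: S)%SET.
Proof.
move=> PhiT PhiC PhiU.
have Phi0 : Phi finset.set0 = finset.set0.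
  by rewrite -finset.setCT PhiC PhiT finset.setCT.
(* The images of the singletons cover [Y]; [kap y] is a singleton whose image contains [y]. *)
have /choice[kap kapP] : forall y, exists i, y \in Phi [set i]%SET.
  move=> y; have : y \in Phi [set: I]%SET by rewrite PhiT inE.
  have -> : [set: I]%SET = (\bigcup_i [set i])%SET.
    by apply/setP => i; rewrite inE; apply/esym/bigcupP; exists i; rewrite ?inE.
  by rewrite (big_morph Phi PhiU Phi0) => /bigcupP[i _]; exists i.
exists kap => S; apply/setP => y; rewrite inE.
have sub (S' : {set I}) : kap y \in S' -> y \in Phi S'.
  move=> kS; have sS' : [set kap y]%SET \subset S' by rewrite finset.sub1set.
  by rewrite -(finset.setUidPr sS') PhiU inE kapP.
apply/idP/idP => [|/sub//]; apply: contraTT => kS.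
(* The converse inclusion is [sub] for the complement of [S]. *)
by have := sub (~: S)%SET; rewrite PhiC !inE; apply.
Qed.

(** * Names of points and the algebra that they generate *)

Section Names.
Variables (G : groupType) (d : measure_display) (X : measurableType d).
Variable a : G -> X -> X.
Hypotheses (a1 : forall x, a 1%g x = x)
  (aM : forall g h x, a (g * h)%g x = a g (a h x)).

Lemma act_image g (A : set X) : a g @` A = a g^-1%g @^-1` A.
Proof.
apply/seteqP; split=> [_ [x Ax <-]|x Ax] /=; first by rewrite -aM mulVg a1.
by exists (a g^-1%g x) => //; rewrite -aM mulgV a1.
Qed.

Definition act_name k (f : X -> 'I_k) (F : {fset G}) (x : X)
    : {ffun F -> 'I_k} :=
  [ffun g : F => f (a (val g)^-1%g x)].

Variables (k : nat) (f : X -> 'I_k) (F : {fset G}).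
Let alpha i := f @^-1` [set i].

Lemma join_atomE (s : {ffun F -> 'I_k}) :
  join_atom a alpha s = act_name f F @^-1` [set s].
Proof.
apply/seteqP; split=> [x xs|x /= <- g _].
  apply/ffunP => g; rewrite ffunE.
  by have := xs g I; rewrite act_image.
by rewrite act_image /alpha /= ffunE.
Qed.

Lemma join_algebraE (A : set X) :
  join_algebra a alpha F A <->
  exists S : {set {ffun F -> 'I_k}}, A = act_name f F @^-1` [set` S].
Proof.
suff E (S : {set {ffun F -> 'I_k}}) :
    \bigcup_(s in [set` S]) join_atom a alpha s = act_name f F @^-1` [set` S].
  by split=> -[S ->]; exists S.
apply/seteqP; split=> [x [s Ss]|x Sx]; first by rewrite join_atomE /= => ->.
by exists (act_name f F x) => //; rewrite join_atomE.
Qed.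

Lemma act_image_name g (gF : g \in F) i :
  a g @` alpha i = act_name f F @^-1` [set s | s [` gF]%fset == i].
Proof.
by rewrite act_image; apply/seteqP; split=> x /=; rewrite ffunE => /eqP.
Qed.

Lemma fin_measurable_act_name : (forall g, measurable_fun setT (a g)) ->
  fin_measurable f -> fin_measurable (act_name f F).
Proof.
move=> ma mf; apply: fin_measurable_fibers => s.
rewrite -join_atomE; apply: fin_bigcap_measurable => // g _.
by rewrite act_image -[_ @^-1` _]setTI; apply: ma => //; exact: mf.
Qed.

End Names.

Lemma fin_act_imset (FF : groupType) (c : fin_action FF) (h : FF)
    (A : {set fcarrier c}) :
  (fin_act h @: A = fin_act h^-1%g @^-1: A)%SET.
Proof.
apply/setP => y; rewrite inE; apply/imsetP/idP => [[z Az ->]|Ay].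
  by rewrite -fin_actM mulVg fin_act1.
by exists (fin_act h^-1%g y) => //; rewrite -fin_actM mulgV fin_act1.
Qed.

Lemma ncount_le_sum (R : realType) (I Y : finType) (A : {set Y})
    (B : I -> {set Y}) :
  A \subset (\bigcup_i B i)%SET -> ncount R A <= \sum_i ncount R (B i).
Proof.
move=> AB; rewrite /ncount -mulr_suml ler_wpM2r ?invr_ge0 ?ler0n//.
rewrite -natr_sum ler_nat; apply: leq_trans (subset_leq_card AB) _.
elim/big_rec2: _ => [|i m S _ le]; first by rewrite cards0.
by apply: leq_trans (leq_card_setU _ _) _; rewrite leq_add2l.
Qed.

Lemma ncount_le (R : realType) (Y : finType) (A B : {set Y}) : A \subset B ->
  ncount R A <= ncount R B.
Proof.
by move=> AB; rewrite ler_wpM2r ?invr_ge0 ?ler0n// ler_nat subset_leq_card.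
Qed.

(** * Almost-homomorphisms as labellings by names *)

Section SoficHomNames.
Variables (R : realType) (FF G : groupType) (rho : G -> FF).
Variables (d : measure_display) (X : measurableType d) (mu : probability X R).
Variable a : G -> X -> X.
Hypotheses (a1 : forall x, a 1%g x = x)
  (aM : forall g h x, a (g * h)%g x = a g (a h x)).
Variables (k : nat) (f : X -> 'I_k) (F : {fset G}) (F1 : 1%g \in F).
Variables (delta : R) (c : fin_action FF).
Let alpha i := f @^-1` [set i].
Let one : F := [` F1]%fset.

(** Since 1 lies in [F], the join refines [alpha], whose pieces can be read off from names. *)
Lemma alpha_name i : alpha i = act_name a f F @^-1` [set s | s one == i].
Proof.
rewrite -(act_image_name a1 aM f F1); apply/seteqP.
by split=> [x ax|_ [x ax <-]]; [exists x => //; rewrite a1|rewrite a1].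
Qed.

Let act_alpha g (gF : g \in F) i :
  a g @` alpha i = act_name a f F @^-1` [set s | s [` gF]%fset == i].
Proof. exact: act_image_name. Qed.

(** The sets of the join algebra correspond to sets of names, so Stone duality turns [phi] into
    [kap]. The factor [k] appears because almost equivariance is assumed one piece at a time, while
    a mismatch may involve any of the [k] pieces. *)
Lemma sofic_hom_names (phi : set X -> {set fcarrier c}) :
  sofic_hom rho mu a alpha F delta phi ->
  exists2 kap : fcarrier c -> {ffun F -> 'I_k},
    forall g (gF : g \in F),
      ncount R [set y | kap (fin_act (rho g)^-1%g y) one !=
                        kap y [` gF]%fset]%SET <= k%:R * delta &
    \sum_s `|ncount R [set y | kap y == s]%SET -
             fine (mu (act_name a f F @^-1` [set s]))| < delta.
Proof.
move=> [[phiT phiC phiU _] phia phimu].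
pose Phi (S : {set {ffun F -> 'I_k}}) := phi (act_name a f F @^-1` [set` S]).
have LS (S : {set {ffun F -> 'I_k}}) :
    join_algebra a alpha F (act_name a f F @^-1` [set` S]).
  by apply/join_algebraE => //; exists S.
have [|S|S S'|kap kapE] := @boolean_hom_dual _ _ Phi.
- by rewrite /Phi -phiT; congr phi; apply/seteqP; split=> x //= _; rewrite inE.
- rewrite /Phi -phiC//; congr phi; apply/seteqP; split=> x /=; rewrite inE.
    by move/negP.
  by move/negP.
- rewrite /Phi -phiU//; congr phi; apply/seteqP; split=> x /=; rewrite inE.
    by move/orP.
  by move/orP.
have phiE (p : pred {ffun F -> 'I_k}) :
    phi (act_name a f F @^-1` [set s | p s]) = [set y | p (kap y)]%SET.
  have -> : [set s | p s] = [set` [set s | p s]%SET].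
    by apply/seteqP; split=> s /=; rewrite inE.
  by rewrite -/(Phi _) kapE; apply/setP => y; rewrite !inE.
exists kap => [g gF|].
  pose D i := (fin_act (rho g) @: phi (alpha i))%SET.
  pose E i := phi (a g @` alpha i).
  (* A mismatch at [y] puts [y] in [E i] but not in [D i], where [i] is the label of [y] at [g]. *)
  have sub : [set y | kap (fin_act (rho g)^-1%g y) one != kap y [` gF]%fset]%SET
      \subset (\bigcup_i ((D i :\: E i) :|: (E i :\: D i)))%SET.
    apply/fintype.subsetP => y; rewrite inE => ne.
    apply/bigcupP; exists (kap y [` gF]%fset) => //.
    rewrite /D /E fin_act_imset act_alpha alpha_name !phiE.
    by rewrite !inE ne eqxx orbT.
  apply: le_trans (ncount_le_sum R sub) _.
  rewrite -[X in X%:R * _]card_ord mulr_natl -sumr_const ler_sum// => i _.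
  exact/ltW/phia.
apply: le_lt_trans phimu; rewrite le_eqVlt; apply/orP; left; apply/eqP.
apply: eq_bigr => s _; rewrite (join_atomE a1 aM).
congr (`|ncount R _ - _|).
rewrite -(phiE (pred1 s)); congr phi.
by apply/seteqP; split=> x /= /eqP.
Qed.

(** A point [q y] with name [kap y] is chosen for each [y], and [phi] is the inverse image under
    [q], which respects all Boolean operations. As no label belongs to a null atom, [phi] is well
    defined modulo null sets on the join algebra. *)
Lemma names_sofic_hom (kap : fcarrier c -> {ffun F -> 'I_k}) :
  fin_measurable (act_name a f F) ->
  (forall y, mu (act_name a f F @^-1` [set kap y]) <> 0%E) ->
  (forall g (gF : g \in F),
      ncount R [set y | kap (fin_act (rho g)^-1%g y) one !=
                        kap y [` gF]%fset]%SET < delta) ->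
  \sum_s `|ncount R [set y | kap y == s]%SET -
             fine (mu (act_name a f F @^-1` [set s]))| < delta ->
  exists phi : set X -> {set fcarrier c}, sofic_hom rho mu a alpha F delta phi.
Proof.
move=> mname kap0 kapa kapmu.
have /choice[q qP] : forall y, exists x, act_name a f F x = kap y.
  move=> y; apply: contrapT => nex; apply: (kap0 y).
  rewrite (_ : _ @^-1` _ = set0) ?measure0//.
  by rewrite -subset0 => x /= xy; apply: nex; exists x.
pose phi (A : set X) := [set y | `[< A (q y) >]]%SET.
have phiE (p : pred {ffun F -> 'I_k}) :
    phi (act_name a f F @^-1` [set s | p s]) = [set y | p (kap y)]%SET.
  apply/setP => y; rewrite !inE -qP; apply/idP/idP => [/asboolP//|py].
  exact/asboolP.
have phiN A : phi (~` A) = (~: phi A)%SET.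
  by apply/setP => y; rewrite !inE; exact: asbool_neg.
exists phi; split.
- split=> [|A _|A B _ _|A B].
  + by apply/setP => y; rewrite !inE; exact/asboolP.
  + exact: phiN.
  + by apply/setP => y; rewrite !inE; exact: asbool_or.
  + move=> /(join_algebraE a1 aM)[S ->] /(join_algebraE a1 aM)[S' ->] AB0.
    (* If [kap y] belonged to only one of [S] and [S'], its atom would lie in the null symmetric
       difference. *)
    have SS' y : kap y \in S = (kap y \in S').
      apply/idP/idP => yS; apply: contrapT => /negP yS'; apply: (kap0 y);
        apply/eqP; rewrite -measure_le0 -AB0 le_measure ?inE//;
        try exact: mname;
        try by apply: measurableU; apply: measurableD; exact: mname.
        by move=> x /= ->; left; split=> //; exact/negP.
      by move=> x /= ->; right; split=> //; exact/negP.
    by rewrite !phiE; apply/setP => y; rewrite !inE.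
- move=> i g gF /=.
  apply: le_lt_trans (kapa g gF); apply: ncount_le; apply/fintype.subsetP => y.
  rewrite fin_act_imset act_alpha alpha_name !phiE !inE.
  by apply: contraTneq => ->; rewrite andNb.
- apply: le_lt_trans kapmu; rewrite le_eqVlt; apply/orP; left; apply/eqP.
  apply: eq_bigr => s _; rewrite (join_atomE a1 aM).
  congr (`|ncount R _ - _|).
  rewrite -(phiE (pred1 s)); congr phi.
  by apply/seteqP; split=> x /= /eqP.
Qed.

End SoficHomNames.

(** * The limit measure and the translation action on the profinite space *)

Section ProfiniteMeasure.
Variables (R : realType) (G : groupType) (H : fin_index_chain G).
Variable muH : probability (profinite_space H) R.
Hypothesis muH_lim : inverse_limit_measure muH.

Definition level n (x : profinite_space H) : coset_space (H n) := pcoord x n.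

Lemma level_measurable n : fin_measurable (@level n).
Proof.
by apply: fin_measurable_fibers => c; apply: sub_sigma_algebra; exists n, c.
Qed.

(** The bridge between counting in $G/H_n$ and measuring in the profinite space: all fibers of the
    projection have the same mass. *)
Lemma ncount_level n (C : {set coset_space (H n)}) :
  ncount R C = fine (muH (@level n @^-1` [set` C])).
Proof.
rewrite (fine_probability_preimage muH (mem C) (@level_measurable n)).
rewrite (eq_bigr (fun=> #|{: coset_space (H n)}|%:R^-1)) => [|c _].
  by rewrite sumr_const /ncount -[RHS]mulr_natl.
by have /= -> := muH_lim c.
Qed.

Lemma lcoset_eq (K : fin_index_subgroup G) (C D : coset_space K) x :
  val C x -> val D x -> C = D.
Proof.
have sub (C' D' : coset_space K) : val C' x -> val D' x -> val C' `<=` val D'.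
  have /in_coset_space[g ->] := valP C'; have /in_coset_space[h ->] := valP D'.
  move=> gx hx y gy; rewrite /lcoset_of /=.
  have -> : (h^-1 * y = (h^-1 * x) * (g^-1 * x)^-1 * (g^-1 * y))%g.
    by rewrite invgM invgK !mulgA !mulgK.
  apply: gpredM gy; apply: gpredM hx _; exact: gpredVr.
by move=> Cx Dx; apply/val_inj/seteqP; split; exact: sub.
Qed.

Lemma coset_nonempty (K : fin_index_subgroup G) (C : coset_space K) :
  exists x, val C x.
Proof.
have /in_coset_space[g ->] := valP C.
by exists g; rewrite /lcoset_of /= mulVg gpred1.
Qed.

Lemma profinite_sub m n (x : profinite H) : (m <= n)%N ->
  val (x n) `<=` val (x m).
Proof.
move=> /subnK <-; elim: (n - m)%N => [//|i IH].
by rewrite addSn; exact: subset_trans (@pcoord_compat _ _ x _) IH.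
Qed.

(** A coset at level [n] is nonempty and lies in a single coset at level [m], because cosets that
    meet are equal. *)
Lemma level_determined m n x y : (m <= n)%N ->
  @level n x = @level n y -> @level m x = @level m y.
Proof.
move=> mn xy; have [z xz] := coset_nonempty (x n).
apply: (@lcoset_eq _ _ _ z); apply: profinite_sub mn _ _ => //.
by rewrite -[y n]xy.
Qed.

Lemma level_lift m n (C : set (coset_space (H m))) : (m <= n)%N ->
  exists D : set (coset_space (H n)), @level m @^-1` C = @level n @^-1` D.
Proof.
move=> mn; exists (@level n @` (@level m @^-1` C)).
apply/seteqP; split=> [x Cx|x [y Cy /(level_determined mn) yx]].
  by exists x.
by rewrite /= -yx.
Qed.

Lemma profinite_ext (x y : profinite H) : (forall n, x n = y n) -> x = y.
Proof.
case: x y => [x xP] [y yP] /= xy.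
have {xy}xy : x = y by apply: functional_extensionality_dep.
by case: _ / xy in yP *; rewrite (Prop_irrelevance xP yP).
Qed.

Lemma profinite_act1 x : profinite_act 1%g x = x :> profinite_space H.
Proof. by apply: profinite_ext => n; exact: coset_act1. Qed.

Lemma profinite_actM g h x :
  profinite_act (g * h)%g x = profinite_act g (profinite_act h x)
    :> profinite_space H.
Proof. by apply: profinite_ext => n; exact: coset_actM. Qed.

(** Arbitrary sets of cosets are allowed so that the family is closed under intersection: two
    disjoint cylinders meet in the empty set, which is not a cylinder. *)
Definition level_sets : set (set (profinite_space H)) :=
  [set A | exists n (C : set (coset_space (H n))), A = @level n @^-1` C].

Lemma setI_closed_level : setI_closed level_sets.
Proof.
move=> _ _ [n [C ->]] [m [D ->]].
have [C' ->] := level_lift C (leq_maxl n m).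
have [D' ->] := level_lift D (leq_maxr n m).
by exists (maxn n m), (C' `&` D').
Qed.

Lemma sigma_level :
  measurable = <<s level_sets >> :> set (set (profinite_space H)).
Proof.
apply/seteqP; split; apply: smallest_sub.
- exact: smallest_sigma_algebra.
- move=> _ [n [c ->]]; apply: sub_sigma_algebra.
  by exists n, [set c].
- exact: sigma_algebra_measurable.
- by move=> _ [n [C ->]]; exact: level_measurable.
Qed.

Lemma profinite_act_measurable g :
  measurable_fun setT (@profinite_act G H g).
Proof.
apply: (@measurability _ _ (profinite_space H) (profinite_space H) setT _
  (@cylinders G H)) => //.
move=> _ [_ [n [c ->]] <-]; rewrite setTI.
have -> : @profinite_act G H g @^-1` [set x | pcoord x n = c] =
   @level n @^-1` [set y | coset_act g y = c] by [].
exact: level_measurable.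
Qed.

HB.instance Definition _ g := @isMeasurableFun.Build _ _ _ _
  (@profinite_act G H g) (profinite_act_measurable g).

Lemma ncount_coset_act n g (C : {set coset_space (H n)}) :
  ncount R (coset_act g @^-1: C)%SET = ncount R C.
Proof.
rewrite /ncount card_preimset//.
apply: (can_inj (g := coset_act g^-1%g)) => c.
by rewrite -coset_actM mulVg coset_act1.
Qed.

(** Two probability measures that agree on a generating family closed under intersection coincide.
    On level sets invariance holds because translation permutes the finite set of cosets. *)
Lemma profinite_act_preserves g A : measurable A ->
  muH (@profinite_act G H g @^-1` A) = muH A.
Proof.
move=> mA.
have g_cover : \bigcup_(k : nat) [set: profinite_space H] = setT.
  by rewrite bigcup_const.
apply: (@measure_unique _ _ _ level_sets (fun=> setT) sigma_level
  setI_closed_level _ g_cover (distribution muH (@profinite_act G H g)) muH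
  _ _ A mA) => /=.
- by move=> _; exists 0%N, setT.
- move=> _ [n [C ->]]; rewrite /distribution /pushforward.
  have CE : C = [set` [set c | `[< C c >]]%SET].
    by apply/seteqP; split=> c /=; rewrite inE => /asboolP.
  pose gC := @profinite_act G H g @^-1` (@level n @^-1` C).
  have gCE : gC = @level n @^-1` [set y | C (coset_act g y)] by [].
  have mgC : measurable gC by rewrite gCE; exact: level_measurable.
  have mC := @level_measurable n C.
  rewrite -/gC (probability_fineE muH mgC) (probability_fineE muH mC) gCE.
  rewrite CE -ncount_level -(ncount_coset_act g) ncount_level.
  by congr (fine (muH _))%:E; apply/seteqP; split=> x /=; rewrite !inE.
- by move=> _; rewrite probability_setT ltry.
Qed.

End ProfiniteMeasure.

(** * Approximation of measurable sets and maps at finite levels *)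

Section Approximation.
Variables (R : realType) (G : groupType) (H : fin_index_chain G).
Variable muH : probability (profinite_space H) R.
Let level := @level G H.

Lemma measurable_setY (A B : set (profinite_space H)) :
  measurable A -> measurable B -> measurable (A `+` B).
Proof. by move=> mA mB; apply: measurableU; exact: measurableD. Qed.

Let approximable (A : set (profinite_space H)) := measurable A /\
  forall e : R, 0 < e -> exists n (C : set (coset_space (H n))),
    fine (muH (A `+` @level n @^-1` C)) < e.

Let approximable_level n (C : set (coset_space (H n))) :
  approximable (@level n @^-1` C).
Proof.
split=> [|e e0]; first exact: level_measurable.
by exists n, C; rewrite setYK measure0.
Qed.

Let approximableU A B : approximable A -> approximable B ->
  approximable (A `|` B).
Proof.
move=> [mA aA] [mB aB]; split=> [|e e0]; first exact: measurableU.
have e2 : 0 < e / 2 by rewrite divr_gt0.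
have [n [C AC]] := aA _ e2; have [m [D BD]] := aB _ e2.
have [C' CC'] := level_lift C (leq_maxl n m).
have [D' DD'] := level_lift D (leq_maxr n m).
exists (maxn n m), (C' `|` D'); rewrite preimage_setU -CC' -DD'.
have mC : measurable (@level n @^-1` C) by exact: level_measurable.
have mD : measurable (@level m @^-1` D) by exact: level_measurable.
rewrite [ltRHS](splitr e); apply: le_lt_trans (ltrD AC BD).
apply: fine_probability_leU; try exact: measurable_setY.
  by apply: measurable_setY; exact: measurableU.
by move=> x [[[Ax|Bx] /not_orP[? ?]]|[[Cx|Dx] /not_orP[? ?]]];
  [left; left|right; left|left; right|right; right].
Qed.

(** Continuity from below replaces the union by a finite one at a cost of [e / 2]; the other half is
    spent on approximating the finite union. *)
Let approximable_bigcup (F : nat -> set (profinite_space H)) :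
  (forall n, approximable (F n)) -> approximable (\bigcup_n F n).
Proof.
move=> aF; have mF n : measurable (F n) by case: (aF n).
have mUF : measurable (\bigcup_n F n) by exact: bigcupT_measurable.
split=> // e e0; have e2 : 0 < e / 2 by rewrite divr_gt0.
pose B n := \big[setU/set0]_(i < n.+1) F i.
have mB n : measurable (B n) by apply: bigsetU_measurable => i _; exact: mF.
have aB n : approximable (B n).
  rewrite /B; elim: n.+1 => [|m IH].
    rewrite big_ord0 -(preimage_set0 (@level 0)).
    exact: approximable_level.
  by rewrite big_ord_recr; exact: approximableU.
have Bsub n : B n `<=` \bigcup_n F n.
  by rewrite /B -bigcup_mkord => x [i _ Fx]; exists i.
have : (muH \o B) x @[x --> \oo] --> muH (\bigcup_n F n).
  rewrite -bigcup_bigsetU_bigcup; apply: nondecreasing_cvg_mu => //.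
    by rewrite bigcup_bigsetU_bigcup.
  move=> n m nm; apply/subsetPset; rewrite /B -!bigcup_mkord.
  by move=> x [i /= ik Fx]; exists i => //=; exact: leq_trans ik _.
rewrite [X in _ --> X]probability_fineE// => /fine_cvgP[_].
move=> /cvgrPdist_lt/(_ _ e2).
case=> n _ /(_ n (leqnn n)) /= Bn.
have [m [C BC]] := (aB n).2 _ e2; exists m, C.
have mC : measurable (@level m @^-1` C) by exact: level_measurable.
have UB : fine (muH (\bigcup_n F n `\` B n)) < e / 2.
  apply: le_lt_trans Bn; rewrite measureD//; last first.
    by rewrite ltey_eq fin_num_measure.
  rewrite setIidr// fineB ?fin_num_measure//; exact: ler_norm.
rewrite [ltRHS](splitr e); apply: le_lt_trans (ltrD UB BC).
apply: fine_probability_leU; try exact: measurable_setY.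
  exact: measurableD.
move=> x [[Ux nCx]|[Cx nUx]]; last by right; right; split=> // /Bsub.
by have [Bx|nBx] := pselect (B n x); [right; left|left].
Qed.

(** The approximable sets contain the cylinders and form a sigma-algebra. *)
Lemma level_approximation A (e : R) : measurable A -> 0 < e ->
  exists n (C : set (coset_space (H n))),
    fine (muH (A `+` @level n @^-1` C)) < e.
Proof.
move=> mA; suff : measurable `<=` approximable by move=> /(_ _ mA)[_]; apply.
apply: smallest_sub => [|_ [n [c ->]]]; last first.
  exact: (@approximable_level n [set c]).
split=> [|B [mB aB]|F aF]; last exact: approximable_bigcup.
  rewrite -(preimage_set0 (@level 0)); exact: approximable_level.
split=> [|e' /aB[n [C BC]]]; first exact: measurableD.
exists n, (~` C); rewrite setTD preimage_setC.
(* A symmetric difference does not change when both sets are complemented. *)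
suff -> : ~` B `+` ~` (@level n @^-1` C) = B `+` @level n @^-1` C by [].
by rewrite /setY !setDE !setCK setUC (setIC (~` B)) (setIC (~` _)).
Qed.

(** Each fiber of [io] is approximated at some level, and [N] is the largest of these. Off the union
    of the symmetric differences, exactly one approximating set contains a given point, and its
    index is the value of [io]. *)
Lemma level_approximation_map (I : finType) (io : profinite_space H -> I)
    (e : R) :
  fin_measurable io -> 0 < e ->
  exists N, forall n, (N <= n)%N -> exists c : coset_space (H n) -> I,
    fine (muH [set x | c (@level n x) <> io x]) < e.
Proof.
move=> mio e0; pose e' := e / #|I|.+1%:R.
have e'0 : 0 < e' by rewrite divr_gt0.
have /choice[C NC] : forall i, exists C : {n & set (coset_space (H n))},
    fine (muH (io @^-1` [set i] `+` @level (tag C) @^-1` (tagged C))) < e'.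
  move=> i.
  have [||n [C iC]] := @level_approximation (io @^-1` [set i]) e' => //.
  by exists (Tagged (fun n => set (coset_space (H n))) C).
exists (\max_i tag (C i))%N => n maxn.
have Nn i : (tag (C i) <= n)%N by exact: leq_trans (leq_bigmax _) maxn.
have /choice[D DC] : forall i, exists D : set (coset_space (H n)),
    @level _ @^-1` (tagged (C i)) = @level n @^-1` D.
  by move=> i; exact: level_lift.
(* The default matters only on the exceptional set, so any value will do. *)
pose c y := odflt (io point) [pick i | `[< D i y >]].
exists c; apply: (@le_lt_trans _ _ (\sum_(i : I) e')); last first.
  rewrite sumr_const -mulr_natl /e' mulrCA -ltr_pdivlMl// mulVf ?gt_eqF//.
  by rewrite ltr_pdivrMr// mul1r ltr_nat.
apply: le_trans (_ : _ <= \sum_i fine (muH (io @^-1` [set i] `+`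
    @level _ @^-1` (tagged (C i))))) _;
  last by apply: ler_sum => i _; exact/ltW.
apply: fine_probability_le_sum.
- have := @fin_measurable_pair _ _ _ _ _ _
    (fin_measurable_comp c (@level_measurable _ H n)) mio.
  by move=> /(_ [set p | p.1 <> p.2]).
- by move=> i; apply: measurable_setY; [exact: mio|exact: level_measurable].
- move=> x /= cx; apply: contrapT => nx.
  have iff i : D i (@level n x) <-> io x = i.
    have : ~ (io @^-1` [set i] `+` @level n @^-1` (D i)) x.
      by rewrite -DC => ?; apply: nx; exists i.
    by move=> /not_orP[nAD nDA]; split=> h; apply: contrapT => nh;
      [apply: nDA|apply: nAD].
  apply: cx; rewrite /c.
  case: pickP => [i /asboolP/iff//|/(_ (io x))/asboolP[]].
  exact/iff.
Qed.

End Approximation.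

(** * Weak containment through real-valued overlaps *)

Section WeakContainment.
Variables (R : realType) (G : groupType).
Variables (d : measure_display) (X : measurableType d) (mu : probability X R).
Variable a : G -> X -> X.
Variables (d' : measure_display) (Y : measurableType d') (nu : probability Y R).
Variable b : G -> Y -> Y.
Hypotheses (a1 : forall x, a 1%g x = x)
  (aM : forall g h x, a (g * h)%g x = a g (a h x))
  (ma : forall g, measurable_fun setT (a g)).
Hypotheses (b1 : forall x, b 1%g x = x)
  (bM : forall g h x, b (g * h)%g x = b g (b h x))
  (mb : forall g, measurable_fun setT (b g)).

Definition overlap_gap (g : G) (A A' : set X) (B B' : set Y) : R :=
  `|fine (mu (A `&` (a g @` A'))) - fine (nu (B `&` (b g @` B')))|.

Let overlap_gapE g A A' B B' : measurable A -> measurable A' ->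
    measurable B -> measurable B' ->
  (`| mu (A `&` (a g @` A')) - nu (B `&` (b g @` B')) |)%E =
  (overlap_gap g A A' B B')%:E.
Proof.
move=> mA mA' mB mB'.
have mAA' : measurable (A `&` (a g @` A')).
  apply: measurableI => //; rewrite act_image// -[_ @^-1` _]setTI.
  exact: ma.
have mBB' : measurable (B `&` (b g @` B')).
  apply: measurableI => //; rewrite act_image// -[_ @^-1` _]setTI.
  exact: mb.
by rewrite (probability_fineE mu mAA') (probability_fineE nu mBB').
Qed.

Let sum_overlap_gapE n (A : 'I_n -> set X) (B : 'I_n -> set Y) (F : {fset G}) :
  mpartition A -> mpartition B ->
  (\sum_(i < n) \sum_(j < n) \sum_(f <- F)
     `| mu (A i `&` (a f @` A j)) - nu (B i `&` (b f @` B j)) |)%E =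
  (\sum_(i < n) \sum_(j < n) \sum_(f <- F)
     overlap_gap f (A i) (A j) (B i) (B j))%:E.
Proof.
move=> [mA _ _] [mB _ _]; rewrite -sumEFin; apply: eq_bigr => i _.
rewrite -sumEFin; apply: eq_bigr => j _.
rewrite -sumEFin; apply: eq_bigr => g _.
exact: overlap_gapE.
Qed.

(** The pieces may be indexed by any finite type, such as the type of names. All terms being
    nonnegative, those of a single [g] add up to at most the whole sum. *)
Lemma weakly_contained_overlap (I : finType) (f : X -> I) (F : {fset G})
    (e : R) :
  weakly_contained mu a nu b -> fin_measurable f -> 0 < e ->
  exists2 h : Y -> I, fin_measurable h & forall g, g \in F ->
    \sum_(p : I * I) overlap_gap g (f @^-1` [set p.1]) (f @^-1` [set p.2])
      (h @^-1` [set p.1]) (h @^-1` [set p.2]) < e.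
Proof.
move=> wc mf e0.
have mrf := fin_measurable_comp enum_rank mf.
have [B mB] := wc e e0 _ _ (index_mpartition mrf) F.
rewrite sum_overlap_gapE//; last exact: index_mpartition.
have [h mh BE] := mpartition_index mB; rewrite {}BE lte_fin => he.
exists (enum_val \o h) => [|g gF]; first exact: fin_measurable_comp.
apply: le_lt_trans he.
rewrite -(pair_bigA _ (fun i j =>
   overlap_gap g (f @^-1` [set i]) (f @^-1` [set j])
     ((enum_val \o h) @^-1` [set i]) ((enum_val \o h) @^-1` [set j]))) /=.
rewrite (reindex (@enum_val I predT))/=; last by apply/onW_bij/enum_val_bij.
apply: ler_sum => i _.
rewrite (reindex (@enum_val I predT))/=; last by apply/onW_bij/enum_val_bij.
apply: ler_sum => j _.
rewrite (bigD1_seq g) ?fset_uniq//=.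
have fE k : (enum_rank \o f) @^-1` [set k] = f @^-1` [set enum_val k].
  apply/seteqP; split=> x /= => [<-|->]; first by rewrite enum_rankK.
  by rewrite enum_valK.
have hE k : (enum_val \o h) @^-1` [set enum_val k] = h @^-1` [set k].
  by apply/seteqP; split=> x /= => [/enum_val_inj|->].
by rewrite !fE !hE lerDl sumr_ge0// => g' _; exact: normr_ge0.
Qed.

Lemma overlap_weakly_contained :
  (forall n (f : X -> 'I_n) (F : {fset G}) (e : R), fin_measurable f -> 0 < e ->
    exists2 h : Y -> 'I_n, fin_measurable h & forall g i j, g \in F ->
    overlap_gap g (f @^-1` [set i]) (f @^-1` [set j])
      (h @^-1` [set i]) (h @^-1` [set j]) <= e) ->
  weakly_contained mu a nu b.
Proof.
move=> ov e e0 n A mA F; have [f mf AE] := mpartition_index mA.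
(* [m] is the number of terms of the triple sum; its successor avoids a division by zero and makes
   the final bound strict. *)
pose m := (n * (n * size F))%N; pose e' := e / m.+1%:R.
have e'0 : 0 < e' by rewrite divr_gt0.
have [h mh hE] := ov n f F e' mf e'0.
exists (fun i => h @^-1` [set i]); first exact: index_mpartition.
rewrite sum_overlap_gapE//; last exact: index_mpartition.
rewrite lte_fin AE.
apply: (@le_lt_trans _ _ (m%:R * e')); last first.
  rewrite /e' mulrCA -ltr_pdivlMl// mulVf ?gt_eqF//.
  by rewrite ltr_pdivrMr// mul1r ltr_nat.
apply: (@le_trans _ _ (\sum_(i < n) \sum_(j < n) \sum_(g <- F) e')).
  apply: ler_sum => i _; apply: ler_sum => j _; rewrite !big_seq.
  by apply: ler_sum => g; exact: hE.
have mE : (size F * (n * n) = m)%N by rewrite /m mulnC -mulnA.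
by rewrite !sumr_const !card_ord big_const_seq count_predT iter_addr_0 -!mulrnA
  mE mulr_natl.
Qed.

End WeakContainment.

(** * Existence of almost-homomorphisms and the sign of the entropy *)

Section Entropy.
Variables (R : realType) (FF G : groupType) (rho : G -> FF).
Variables (d : measure_display) (X : measurableType d) (mu : probability X R).
Variable a : G -> X -> X.
Variables (u : set_system nat) (u_ultra : UltraFilter u).
Hypothesis u_np : nonprincipal u.
Variable Sigma : nat -> fin_action FF.
Variables (m : nat) (xi : 'I_m -> set X) (k : nat) (alpha : 'I_k -> set X).
Variables (F : {fset G}) (delta : R).

(** The ultrafilter contains the complement of every singleton, and a tail is a finite intersection
    of such complements. *)
Lemma nonprincipal_tail N : u [set n | (N <= n)%N].
Proof.
elim: N => [|N IH]; first by apply: filterS filterT.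
have uN : u (~` [set N]).
  by case: (in_ultra_setVsetC [set N] u_ultra) => // /u_np.
apply: filterS (filterI IH uN) => n /= [Nn nN].
by rewrite ltn_neqAle Nn andbT eq_sym; apply/eqP.
Qed.

Lemma sofic_hom_card_gt0 (c : fin_action FF) :
  (0 < sofic_hom_card rho mu a alpha F delta c xi)%N <->
  exists phi : set X -> {set fcarrier c}, sofic_hom rho mu a alpha F delta phi.
Proof.
split=> [/card_gt0P[t]|[phi hphi]].
  by rewrite inE => /asboolP[phi hphi _]; exists phi.
apply/card_gt0P; exists [ffun j => phi (xi j)]; rewrite inE; apply/asboolP.
by exists phi => // j; rewrite ffunE.
Qed.

(** If there were no almost-homomorphism at any index, every term would be a positive multiple of
    log 0, and the limit of the constant [-oo] is [-oo]. *)
Lemma entropy_at_hom : (-oo < entropy_at rho mu a u Sigma xi alpha F delta)%E ->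
  exists n (phi : set X -> {set fcarrier (Sigma n)}),
    sofic_hom rho mu a alpha F delta phi.
Proof.
rewrite ltNye; apply: contra_neqP => nphi.
rewrite /entropy_at (_ : (fun n => _) = fun=> -oo%E); first exact: lim_cst.
apply/funext => n.
have -> : sofic_hom_card rho mu a alpha F delta (Sigma n) xi = 0%N.
  apply/eqP; rewrite -leqn0 leqNgt; apply/negP => /sofic_hom_card_gt0 ?.
  by apply: nphi; exists n.
by rewrite le0_lneNy// gt0_muleNy// lte_fin invr_gt0 ltr0n fcarrier_gt0.
Qed.

Lemma hom_entropy_at_ge0 :
  (exists N, forall n, (N <= n)%N ->
    exists phi : set X -> {set fcarrier (Sigma n)},
      sofic_hom rho mu a alpha F delta phi) ->
  (0 <= entropy_at rho mu a u Sigma xi alpha F delta)%E.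
Proof.
move=> [N homN]; rewrite /entropy_at.
set v := (fun n => _).
have v0 : u [set n | (0 <= v n)%E].
  apply: filterS (nonprincipal_tail N) => n /homN /sofic_hom_card_gt0 c0.
  apply: mule_ge0; first by rewrite lee_fin invr_ge0.
  by rewrite lne_ge0 lee_fin ler1n.
(* If the limit does not exist, [lim] takes the default value [0]. *)
have [cv|ncv] := pselect (cvg (v @ u)); first exact: lime_ge.
by rewrite dvgP.
Qed.

End Entropy.

(** * Passage between labellings of $G/H_n$ and partitions of the profinite space *)

Section Transfer.
Variables (R : realType) (FF G : groupType) (pi : {multiplicative FF -> G}).
Variables (rho : G -> FF) (rho_section : cancel rho pi).
Variables (H : fin_index_chain G) (muH : probability (profinite_space H) R).
Hypothesis muH_lim : inverse_limit_measure muH.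
Variables (d : measure_display) (X : measurableType d) (mu : probability X R).
Variable b : G -> X -> X.
Hypotheses (b1 : forall x, b 1%g x = x)
  (bM : forall g h x, b (g * h)%g x = b g (b h x))
  (mb : forall g, measurable_fun setT (b g)).
Let act := @profinite_act G H.

(** [rho] need not be multiplicative, but [pi] still sends the inverse of [rho g] to the inverse of
    [g]. *)
Let fin_act_rho n g (y : fcarrier (coset_fin_action pi (H n))) :
  fin_act (rho g)^-1%g y = coset_act g^-1%g y.
Proof.
rewrite -[LHS]/(coset_act (pi (rho g)^-1%g) y); congr (coset_act _ y).
have pi1 : pi 1%g = 1%g by apply: (@mulgI _ (pi 1%g)); rewrite -gmulfM !mulg1.
by apply: (@mulgI _ (pi (rho g))); rewrite -gmulfM mulgV pi1 rho_section mulgV.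
Qed.

Let ncount_names n (I : finType) (kap : coset_space (H n) -> I) (s : I) :
  ncount R [set y | kap y == s]%SET =
  fine (muH ((kap \o @level _ H n) @^-1` [set s])).
Proof.
rewrite (ncount_level muH_lim); congr (fine (muH _)).
by apply/seteqP; split=> x /=; rewrite inE => /eqP.
Qed.

Let ncount_mismatch n (I J : finType) (kap : coset_space (H n) -> I) g
    (p q : I -> J) :
  ncount R [set y : fcarrier (coset_fin_action pi (H n)) |
    p (kap (fin_act (rho g)^-1%g y)) != q (kap y)]%SET =
  fine (muH [set x | p (kap (@level _ H n (act g^-1%g x))) <>
                     q (kap (@level _ H n x))]).
Proof.
transitivity (ncount R [set y : coset_space (H n) |
    p (kap (coset_act g^-1%g y)) != q (kap y)]%SET).
  congr (ncount R _); apply/setP => y; rewrite !inE.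
  by have /= -> := fin_act_rho g y.
rewrite (ncount_level muH_lim); congr (fine (muH _)).
by apply/seteqP; split=> x /=; rewrite inE => /eqP.
Qed.

Let fin_measurable_act (I : finType) (h : profinite_space H -> I) g :
  fin_measurable h -> fin_measurable (h \o act g).
Proof.
move=> mh D; rewrite comp_preimage -[_ @^-1` _]setTI.
by apply: profinite_act_measurable => //; exact: mh.
Qed.

Lemma homs_weakly_contained m (xi : 'I_m -> set X) : mpartition xi ->
  (forall k (alpha : 'I_k -> set X) (F : {fset G}) (delta : R),
    mpartition alpha -> finer alpha xi -> 1%g \in F -> 0 < delta ->
    exists n (phi : set X -> {set fcarrier (coset_fin_action pi (H n))}),
      sofic_hom rho mu b alpha F delta phi) ->
  weakly_contained mu b muH act.
Proof.
move=> /mpartition_index[fx mfx ->] homs.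
apply: overlap_weakly_contained => //.
- exact: profinite_act1.
- exact: profinite_actM.
move=> n f F e mf e0.
pose k := #|{: 'I_n * 'I_m}|; pose F' : {fset G} := (1%g |` F)%fset.
(* The partition of [f] is joined with [xi], since almost-homomorphisms are provided for refinements
   of [xi]. *)
pose fa x : 'I_k := enum_rank (f x, fx x).
have mfa : fin_measurable fa.
  exact: fin_measurable_comp (fin_measurable_pair mf mfx).
(* Mismatches will cost [k%:R * de] and the distribution of names [de], which add up to [e]. *)
pose de := e / k.+1%:R; have de0 : 0 < de by rewrite divr_gt0.
have F1 : 1%g \in F' by rewrite !inE eqxx.
have [||//|//|N [phi]] := homs k (fun i => fa @^-1` [set i]) F' de.
- exact: index_mpartition.
- by move=> i; exists (enum_val i).2 => x /= <-; rewrite enum_rankK.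
move=> /(sofic_hom_names b1 bM F1)[kap kapa kapmu].
pose p (i : 'I_k) := (enum_val i).1.
pose lv := @level G H N.
pose h x := p (kap (lv x) [` F1]%fset).
have mh : fin_measurable h.
  exact: (fin_measurable_comp (fun y => p (kap y [` F1]%fset))
    (@level_measurable _ H N)).
exists h => // g i j gF.
have gF' : g \in F' by rewrite !inE gF orbT.
(* In [X] the overlap is the set of points whose name lies in [S]; in the
   profinite space this is only approximate, since the name of [g^-1 x] at [1]
   may differ from the name of [x] at [g]. *)
have {kapa}:= kapa g gF'.
pose q1 (s : {ffun F' -> 'I_k}) := s [` F1]%fset.
pose qg (s : {ffun F' -> 'I_k}) := s [` gF']%fset.
rewrite (@ncount_mismatch N _ _ kap g q1 qg) => kapa.
pose S := [pred s | (p (q1 s) == i) && (p (qg s) == j)].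
have mkap : fin_measurable (kap \o lv).
  exact: (fin_measurable_comp kap (@level_measurable _ H N)).
have mname : fin_measurable (act_name b fa F').
  exact: (fin_measurable_act_name b1 bM).
rewrite /overlap_gap.
have -> : f @^-1` [set i] `&` b g @` (f @^-1` [set j]) =
    act_name b fa F' @^-1` [set s | s \in S].
  rewrite act_image//; apply/seteqP; split=> x /=.
    move=> [fi fj]; rewrite !inE /= /q1 /qg !ffunE /= /p !enum_rankK /=.
    by rewrite invg1 b1 fi fj !eqxx.
  rewrite !inE /= /q1 /qg !ffunE /= /p !enum_rankK /=.
  by rewrite invg1 b1 => /andP[/eqP -> /eqP ->].
have -> : h @^-1` [set i] `&` act g @` (h @^-1` [set j]) =
    [set x | h x = i /\ h (act g^-1%g x) = j].
  by rewrite (act_image (@profinite_act1 _ H) (@profinite_actM _ H)).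
have close1 := fine_probability_preimage_dist mu muH (mem S) mname mkap.
have close2 : `|fine (muH ((kap \o lv) @^-1` [set s | s \in S])) -
    fine (muH [set x | h x = i /\ h (act g^-1%g x) = j])| <= k%:R * de.
  apply: le_trans kapa; apply: fine_probability_dist.
  - exact: mkap.
  - exact: (fin_measurable_pair mh (fin_measurable_act g^-1%g mh))
      [set z | z.1 = i /\ z.2 = j].
  - exact: (fin_measurable_pair mkap (fin_measurable_act g^-1%g mkap))
      [set z | q1 z.2 <> qg z.1].
  - move=> x; rewrite /= !inE /= => /andP[/eqP hi /eqP hj].
    have [e1|ne1] :=
      pselect (q1 (kap (lv (act g^-1%g x))) = qg (kap (lv x))); last by right.
    by left; split=> //; rewrite /h -/(q1 _) e1.
  - move=> x [/= hi hj].
    have [e1|ne1] :=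
      pselect (q1 (kap (lv (act g^-1%g x))) = qg (kap (lv x))); last by right.
    by left; rewrite /= !inE /= -e1; apply/andP; split; apply/eqP.
have {}kapmu : \sum_s `|fine (mu (act_name b fa F' @^-1` [set s])) -
    fine (muH ((kap \o lv) @^-1` [set s]))| < de.
  apply: le_lt_trans kapmu; apply: ler_sum => s _.
  by rewrite distrC ncount_names.
have eE : e = k%:R * de + de.
  by rewrite -[X in _ + X]mul1r -mulrDl natr1 mulrC divfK.
apply: le_trans
  (ler_distD (fine (muH ((kap \o lv) @^-1` [set s | s \in S]))) _ _) _.
by rewrite eE addrC lerD// ltW// (le_lt_trans close1).
Qed.

(** Weak containment is applied to the partition by names rather than to [f]: overlaps of its atoms
    control both the distribution of the labels and their equivariance. *)
Lemma weakly_contained_homs k (f : X -> 'I_k) (F : {fset G}) (delta : R) :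
  weakly_contained mu b muH act -> fin_measurable f -> 1%g \in F -> 0 < delta ->
  exists N, forall n, (N <= n)%N ->
    exists phi : set X -> {set fcarrier (coset_fin_action pi (H n))},
      sofic_hom rho mu b (fun i => f @^-1` [set i]) F delta phi.
Proof.
move=> wc mf F1 delta0.
pose I : finType := {ffun F -> 'I_k}; pose nm : X -> I := act_name b f F.
have mnm : fin_measurable nm by exact: (fin_measurable_act_name b1 bM).
(* Equivariance will cost [5 * e] and the distribution of labels at most [(2 * #|I| + 1) * e]; both
   stay below [(2 * #|I| + 6) * e], which is [delta]. *)
pose e := delta / (2 * #|I| + 6)%N%:R.
have e0 : 0 < e by rewrite divr_gt0// ltr0n addn_gt0 orbT.
have [h mh hgap] : exists2 h : profinite_space H -> I, fin_measurable h &
    forall g, g \in F -> \sum_(p : I * I)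
      overlap_gap mu b muH act g (nm @^-1` [set p.1]) (nm @^-1` [set p.2])
        (h @^-1` [set p.1]) (h @^-1` [set p.2]) < e.
  apply: weakly_contained_overlap => //.
  - exact: profinite_act1.
  - exact: profinite_actM.
(* For [g = 1] the diagonal overlaps are the atoms themselves. *)
have gap1 : \sum_s `|fine (mu (nm @^-1` [set s])) -
                     fine (muH (h @^-1` [set s]))| < e.
  apply: le_lt_trans (hgap _ F1).
  rewrite -(pair_bigA _ (fun s t => overlap_gap mu b muH act 1%g
    (nm @^-1` [set s]) (nm @^-1` [set t])
    (h @^-1` [set s]) (h @^-1` [set t])))/=.
  apply: ler_sum => s _; rewrite (bigD1 s)//= {1}/overlap_gap.
  have b1E (A : set X) : b 1%g @` A = A.
    by rewrite act_image// invg1; apply/seteqP; split=> x; rewrite /= b1.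
  have act1E (A : set (profinite_space H)) : act 1%g @` A = A.
    by apply/seteqP; split=> [_ [x Ax <-]|x Ax]; [|exists x => //];
      rewrite /act profinite_act1.
  rewrite b1E act1E !setIid lerDl.
  by apply: sumr_ge0 => t _; exact: normr_ge0.
(* In [X] the name of $g^{-1}x$ at 1 always agrees with the name of [x] at [g], so the overlaps of
   pairs in [D] are empty there. Hence the corresponding overlaps for [h] have total mass at most
   [e]. *)
have mis g (gF : g \in F) :
    fine (muH [set x | (h (act g^-1%g x)) [` F1]%fset <> (h x) [` gF]%fset])
    <= e.
  pose D := [pred p : I * I | p.2 [` F1]%fset != p.1 [` gF]%fset].
  pose hh x := (h x, h (act g^-1%g x)).
  have mhh : fin_measurable hh.
    exact: fin_measurable_pair mh (fin_measurable_act g^-1%g mh).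
  have -> : [set x | (h (act g^-1%g x)) [` F1]%fset <> (h x) [` gF]%fset] =
      hh @^-1` [set p | p \in D].
    by apply/seteqP; split=> x /=; rewrite inE /= => /eqP.
  rewrite fine_probability_preimage//; apply: le_trans (ltW (hgap g gF)).
  rewrite [leRHS](bigID (mem D))/= -[leLHS]addr0 lerD//; last first.
    by apply: sumr_ge0 => p _; exact: normr_ge0.
  apply: ler_sum => -[s t]; rewrite inE /= => st.
  rewrite /overlap_gap (act_image (@profinite_act1 _ H) (@profinite_actM _ H)).
  rewrite (_ : nm @^-1` _ `&` _ = set0) ?measure0 ?sub0r ?normrN; last first.
    rewrite -subset0 => x; rewrite act_image// => -[/= xs xt].
    move/eqP: st; apply; rewrite -xs -xt !ffunE /=.
    by rewrite invg1 b1.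
  rewrite ger0_norm ?fine_ge0//.
  rewrite le_eqVlt; apply/orP; left; apply/eqP; congr (fine (muH _)).
  by apply/seteqP; split=> x; rewrite /hh /= => -[<- <-].
(* Null names have no mass under [mu], so the mass that [h] gives them is part of the distance in
   [gap1]. *)
have null_h : fine (muH [set x | mu (nm @^-1` [set h x]) = 0%E]) <= e.
  pose D := [pred s : I | mu (nm @^-1` [set s]) == 0%E].
  have -> : [set x | mu (nm @^-1` [set h x]) = 0%E] = h @^-1` [set s | s \in D].
    by apply/seteqP; split=> x /=; rewrite inE /= => /eqP.
  rewrite fine_probability_preimage//; apply: le_trans (ltW gap1).
  rewrite [leRHS](bigID (mem D))/= -[leLHS]addr0 lerD//; last first.
    by apply: sumr_ge0.
  apply: ler_sum => s; rewrite inE => /eqP ->.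
  by rewrite sub0r normrN ler_norm.
(* The masses of the atoms add up to 1. *)
have [s0 s00] : exists s, mu (nm @^-1` [set s]) <> 0%E.
  apply: contrapT => /forallNP all0.
  have := fine_probability_preimage mu predT mnm.
  rewrite big1 => [|s _]; last by have /contrapT -> := all0 s.
  rewrite (_ : nm @^-1` _ = setT) ?probability_setT /=; last exact/seteqP.
  by move/eqP; rewrite oner_eq0.
have [N approx] := level_approximation_map muH mh e0.
exists N => n /approx[c hc].
(* A homomorphism must send null atoms to the empty set, so the points carrying
   the name of a null atom are renamed. *)
pose r s := if mu (nm @^-1` [set s]) == 0%E then s0 else s.
pose kap y : I := r (c y).
pose ka := kap \o @level _ H n.
have mlevel := @level_measurable _ H n.
have mka : fin_measurable ka := fin_measurable_comp kap mlevel.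
have mc : fin_measurable (c \o @level _ H n) := fin_measurable_comp c mlevel.
pose E := [set x | ka x <> h x].
have mE : measurable E.
  exact: (fin_measurable_pair mka mh) [set p | p.1 <> p.2].
(* [kap] differs from [h] either where [c] fails to approximate [h] or where [h] takes a null name;
   each case costs [e]. *)
have hE : fine (muH E) <= 2 * e.
  rewrite mulr_natl mulr2n.
  apply: le_trans (lerD (ltW hc) null_h); apply: fine_probability_leU => //.
  - exact: (fin_measurable_pair mc mh) [set p | p.1 <> p.2].
  - exact: mh [set s | mu (nm @^-1` [set s]) = 0%E].
  - move=> x; rewrite /E /ka /= /kap /r => kx.
    have [ch|] := pselect (c (@level _ H n x) = h x); last by left.
    right; move: kx; rewrite /= ch.
    by case: eqP => // _ [].
have small : (2 * #|I|%:R) * e + 5 * e < delta.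
  rewrite -mulrDl -natrM -natrD /e mulrCA -ltr_pdivlMl// mulVf ?gt_eqF//.
  by rewrite ltr_pdivrMr ?ltr0n ?addn_gt0 ?orbT// mul1r ltr_nat ltn_add2l.
apply: (@names_sofic_hom _ _ _ _ _ _ _ _ b1 bM _ _ _ F1 _
  (coset_fin_action pi (H n)) kap) => //.
- move=> y; rewrite /kap /r; case: eqP => // _.
- move=> g gF.
  pose q1 (s : I) := s [` F1]%fset; pose qg (s : I) := s [` gF]%fset.
  rewrite (@ncount_mismatch n _ _ kap g q1 qg).
  have mEg : measurable (act g^-1%g @^-1` E).
    rewrite -[_ @^-1` _]setTI.
    exact: profinite_act_measurable.
  have mM : measurable
      [set x | (h (act g^-1%g x)) [` F1]%fset <> (h x) [` gF]%fset].
    exact: (fin_measurable_pair mh (fin_measurable_act g^-1%g mh))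
      [set p | q1 p.2 <> qg p.1].
  (* [E] and its translate, of equal measure, cost [2 * e] each; the mismatches of [h] itself cost
     [e]. *)
  apply: (@le_lt_trans _ _ (2 * e + 2 * e + e)); last first.
    apply: le_lt_trans small.
    have : 0 <= 2 * #|I|%:R * e by rewrite !mulr_ge0// ltW.
    by lra.
  apply: (@le_trans _ _ (fine (muH (E `|` act g^-1%g @^-1` E)) + e)).
    apply: le_trans (lerD (lexx _) (mis g gF)).
    apply: fine_probability_leU => //; last first.
    + move=> x /= ne; apply: contrapT => /not_orP[/not_orP[nE nEg] nM].
      apply: ne; rewrite /q1 /qg.
      have -> : kap (@level _ H n (act g^-1%g x)) = h (act g^-1%g x).
        exact: contrapT.
      have -> : kap (@level _ H n x) = h x by exact: contrapT.
      exact: contrapT.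
    + exact: measurableU.
    + exact: (fin_measurable_pair mka (fin_measurable_act g^-1%g mka))
        [set p | q1 p.2 <> qg p.1].
  rewrite lerD2r.
  apply: (@le_trans _ _ (fine (muH E) + fine (muH (act g^-1%g @^-1` E)))).
    by apply: fine_probability_leU => //; exact: measurableU.
  by rewrite (profinite_act_preserves muH_lim)// lerD.
(* Replacing [kap] by [h] moves the mass of each label by at most the measure of [E]. *)
- apply: (@le_lt_trans _ _ (\sum_(s : I) (2 * e +
      `|fine (mu (nm @^-1` [set s])) - fine (muH (h @^-1` [set s]))|))).
    apply: ler_sum => s _; rewrite ncount_names distrC.
    apply: le_trans (ler_distD (fine (muH (h @^-1` [set s]))) _ _) _.
    rewrite addrC lerD2r; apply: le_trans hE.
    apply: fine_probability_dist => //.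
    + move=> x hx; have [kx|nkx] := pselect (ka x = s); [by left|right].
      by move=> kh; apply: nkx; exact: etrans kh hx.
    + move=> x kx; have [hx|nhx] := pselect (h x = s); [by left|right].
      by move=> kh; apply: nhx; exact: etrans (esym kh) kx.
  rewrite big_split/= sumr_const -mulrnAl -[2 *+ _]mulr_natr.
  apply: le_lt_trans small; rewrite lerD2l (le_trans (ltW gap1))//.
  by lra.
Qed.

End Transfer.

Theorem proposition3 (R : realType)
    (u : set_system nat) (u_ultra : UltraFilter u) (u_np : nonprincipal u)
    (G : groupType) (G_countable : countable [set: G])
    (G_rf : residually_finite G)
    (FF : groupType) (FF_countable : countable [set: FF])
    (FF_free : free_group FF)
    (pi : {multiplicative FF -> G}) (pi_surj : forall g : G, exists x, pi x = g)
    (rho : G -> FF) (rho_section : cancel rho pi) (rho1 : rho 1%g = 1%g)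
    (H : fin_index_chain G)
    (muH : probability (profinite_space H) R)
    (muH_lim : inverse_limit_measure muH)
    (H_free : free_action muH (@profinite_act G H))
    (d : measure_display) (X : measurableType d) (X_std : standard_borel R X)
    (mu : probability X R) (b : G -> X -> X) (b_pmp : pmp_action mu b) :
  (-oo < sofic_entropy rho mu b u (coset_sofic_approx pi H))%E <->
  weakly_contained mu b muH (@profinite_act G H).
Proof.
have [b1 bM mb _] := b_pmp.
(* A supremum above [-oo] yields one [xi] whose infimum is above [-oo], and so is [entropy_at] for
   every [alpha], [F] and [delta] below it. *)
split=> [/ereal_sup_gt[_ [m [xi [mxi ->]]] inf_gt]|wc].
  apply: (homs_weakly_contained rho_section muH_lim b1 bM mb mxi).
  move=> k alpha F delta malpha finer_alpha F1 delta0.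
  apply: (@entropy_at_hom _ _ _ rho _ _ mu b u u_ultra
    (coset_sofic_approx pi H) m xi).
  apply: lt_le_trans inf_gt _.
  apply: le_trans (ereal_inf_lbound _) _; first by exists k, alpha.
  apply: le_trans (ereal_inf_lbound _) _; first by exists F.
  by apply: ereal_inf_lbound; exists delta.
apply: (@lt_le_trans _ _ 0%E) => //.
(* One partition suffices to bound the supremum from below; the trivial one is taken. *)
pose xi (j : 'I_1) : set X := setT.
apply: le_trans (ereal_sup_ubound _); last first.
  exists 1%N, xi; split=> //; split=> //.
  - by move=> i; exact: measurableT.
  - by move=> i j _ _ _; rewrite (ord1 i) (ord1 j).
  - by apply/seteqP; split=> // x _; exists ord0.
apply: le_ereal_inf_tmp => _ [k [alpha [/mpartition_index[f mf ->] _ ->]]].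
apply: le_ereal_inf_tmp => _ [F [F1 ->]].
apply: le_ereal_inf_tmp => _ [delta delta0 <-].
exact/hom_entropy_at_ge0/weakly_contained_homs.
Qed.
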